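(* Consider the stochastic environment $\mathrm{d}X_t = f(X_t,U_t)\,\mathrm{d}t + \sigma(X_t,U_t)\,\mathrm{d}B_t$ driven by a behavior policy $\mu$, i.e. $U_t=\mu(X_t)$, and let the critic weight error $\tilde\Theta_t$ (with initial value $\tilde\theta(0)$) evolve according to $$\mathrm{d}\|\tilde\Theta_t\|^2 = -\alpha\left(\tilde\Theta_t^{\top}\mathcal{E}_t\tilde\Theta_t + \sum_{k=1}^{M}\frac{\tilde\Theta_t^{\top}W_{t_k}\left(\mathcal{H}(X_{t_k},U_{t_k}\mid V)-\delta_{\mathcal{H}}(X_{t_k},U_{t_k})\right)}{\left(W_{t_k}^{\top}W_{t_k}+1\right)^2}\right)\mathrm{d}t,$$ where $\mathcal{E}_t := \sum_{k=1}^{M}\frac{W_{t_k}W_{t_k}^{\top}}{(W_{t_k}^{\top}W_{t_k}+1)^2}$ and $\alpha>0$ is the learning rate. Let the following conditions hold: (a) $f(\cdot,\mu(\cdot))$ and $\sigma(\cdot,\mu(\cdot))$ are of linear growth, and $\mu(0)=0$, $f(0,0)=0$, $\sigma(0,0)=0$; (b) the critic topology is chosen such that the value function approximation error $\delta$ is of quadratic growth and $\delta(0)=0$; (c) $\rho$ and $V$ are of quadratic growth; (d) the behavior policy is persistently exciting, i.e. $\mathcal{E}_t\succeq\varepsilon I$ almost surely (for all $t\ge 0$, with a fixed $\varepsilon>0$); (e) there exists $\bar X>0$ such that for all $t\ge 0$, $\mathbb{E}\left[\|X_t\|^4\right]\le\bar X^2$. Then there is a constant $D$ such that for all $t\ge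 0$ the critic weight error satisfies $$\mathbb{E}\left[\|\tilde\Theta_t\|^2\right]\le e^{-\alpha\varepsilon t}\|\tilde\theta(0)\|^2 + D\sup_{\tau\le t}\sqrt{\mathbb{E}\left[\|\tilde\Theta_\tau\|^2\right]}.$$
   Context: **Environment.** $X_t\in\mathbb{R}^n$ is the state and $U_t\in\mathbb{R}^m$ the action. $\{B_t\}$ is a vector Brownian motion, $f$ is the drift and $\sigma$ is the (matrix-valued) diffusion coefficient. **Optimal control problem.** Let $\rho(x,u)$ be a stage cost and $\gamma$ a discounting factor. For a policy $\kappa$ (a map from states to actions), with $U_t=\kappa(X_t)$, set $$J^\kappa(x_0)=\mathbb{E}\left[\int_0^\infty e^{-\gamma t}\rho(X_t,\kappa(X_t))\,\mathrm{d}t\,\Big|\,X_0=x_0\right].$$ The value function is $V:=\min_\kappa J^\kappa$. **Hamiltonian.** For a generic smooth function $h$, $$\mathcal{H}(x,u\mid h)=\nabla h(x)^{\top}f(x,u)+\tfrac12\operatorname{tr}\left(\sigma^{\top}(x,u)\nabla^2h(x)\sigma(x,u)\right)+\rho(x,u)-\gamma h(x).$$ **Critic.** The critic is a one-hidden-layer neural network $\hat V_\theta(x)=\theta^{\top}\varphi(x)$ with weights $\theta\in\mathbb{R}^{N_c}$ and activation functions (features) $\varphi=(\varphi_1,\dots,\varphi_{N_c})$. For some ideal weights $\theta^*$ one has $V(x)={\theta^*}^{\top}\varphi(x)+\delta(x)$, where $\delta$ is the value function approximation error. The Hamiltonian approximation error is $$\delta_{\mathcal{H}}(x,u)=\nabla\delta(x)^{\top}f(x,u)+\tfrac12\operatorname{tr}\left(\sigma^{\top}(x,u)\nabla^2\delta(x)\sigma(x,u)\right)-\gamma\delta(x).$$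 **Data vectors.** Let $\nabla\varphi(x)$ be the matrix whose $i$-th row is $\nabla\varphi_i(x)^{\top}$, and let $\eta(x,u)\in\mathbb{R}^{N_c}$ have entries $\operatorname{tr}(\sigma^{\top}(x,u)\nabla^2\varphi_i(x)\sigma(x,u))$, $i=1,\dots,N_c$. Define $$w(x,u):=\nabla\varphi(x)f(x,u)+\tfrac12\eta(x,u)-\gamma\varphi(x),\qquad W_t:=w(X_t,U_t).$$ **Experience replay.** At each time $t$ the critic uses an experience replay $\{X_{t_k},U_{t_k}\}_{k=1}^M$ of fixed size $M$, with sampling times $t_1<t_2<\dots<t_M$ and $(X_{t_M},U_{t_M})=(X_t,U_t)$. **Weights.** $\Theta_t$ denotes the critic weights at time $t$, viewed as a stochastic process, and $\tilde\Theta_t:=\Theta_t-\theta^*$ is the critic weight error, with initial value $\tilde\theta(0)$. $\|\cdot\|$ is the Euclidean norm, $I$ is the identity matrix, and $\succeq$ is the positive semidefinite order.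
   Formalization: Quadratic growth of ρ in (c) is required along the behavior policy, of x ↦ ρ(x,μ(x)); with only joint growth in (x,u) the claim fails, e.g. ρ=u², μ(x)=x³, dX=−1.5X dt+X dB, φ=1. Past data may start at a time t₀≤0, with (e) on [t₀,∞). *)

(* Defs.v *)
From HB Require Import structures.
From mathcomp Require Import all_boot all_order all_algebra.
From mathcomp Require Import all_classical all_reals all_analysis.

Set Implicit Arguments.
Unset Strict Implicit.
Unset Printing Implicit Defensive.

Import Order.TTheory GRing.Theory Num.Theory.
Import numFieldNormedType.Exports.

Local Open Scope classical_set_scope.
Local Open Scope ring_scope.

(* The library's own norm on matrices is the max norm. On column vectors
   [enorm] is the Euclidean norm, on general matrices the Frobenius norm. *)
Definition enorm (R : realType) p q (A : 'M[R]_(p, q)) : R :=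
  Num.sqrt (\sum_i \sum_j A i j ^+ 2).

Definition dot (R : realType) p (u v : 'cV[R]_p) : R := (u^T *m v) 0 0.

Definition psd (R : realType) p (A : 'M[R]_p) : Prop :=
  A^T = A /\ forall v : 'cV[R]_p, 0 <= dot v (A *m v).

Definition loewner_ge (R : realType) p (A B : 'M[R]_p) : Prop := psd (A - B).

Definition linear_growth (R : realType) n p q
    (h : 'cV[R]_n -> 'M[R]_(p, q)) : Prop :=
  exists C : R, forall x, enorm (h x) <= C * (1 + enorm x).

Definition quadratic_growth (R : realType) n (h : 'cV[R]_n -> R) : Prop :=
  exists C : R, forall x, `|h x| <= C * (1 + enorm x ^+ 2).

(* The space of column vectors with its Borel sigma-algebra. *)
Definition borel_cV (R : realType) n :=
  g_sigma_algebraType (@open 'cV[R]_n).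

Definition borel_fun (R : realType) n p q
    (h : 'cV[R]_n -> 'M[R]_(p, q)) : Prop :=
  forall i j, measurable_fun [set: borel_cV R n]
    (fun x : borel_cV R n => h x i j).

Definition borel_fun2 (R : realType) n m p q
    (h : 'cV[R]_n -> 'cV[R]_m -> 'M[R]_(p, q)) : Prop :=
  forall i j, measurable_fun [set: borel_cV R n * borel_cV R m]
    (fun z : borel_cV R n * borel_cV R m => h z.1 z.2 i j).

Definition partial (R : realType) n (i : 'I_n) (h : 'cV[R]_n -> R)
    (x : 'cV[R]_n) : R :=
  'D_(delta_mx i 0 : 'cV[R]_n) h x.

Definition grad (R : realType) n (h : 'cV[R]_n -> R) (x : 'cV[R]_n) :
    'cV[R]_n :=
  \col_i partial i h x.

Definition hess (R : realType) n (h : 'cV[R]_n -> R) (x : 'cV[R]_n) :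
    'M[R]_n :=
  \matrix_(i, j) partial i (partial j h) x.

Definition C2 (R : realType) n (h : 'cV[R]_n -> R) : Prop :=
  [/\ forall i x, derivable h x (delta_mx i 0 : 'cV[R]_n),
      forall i, continuous (partial i h),
      forall i j x, derivable (partial i h) x (delta_mx j 0 : 'cV[R]_n) &
      forall i j, continuous (partial j (partial i h))].

Definition hamiltonian (R : realType) n m l
    (f : 'cV[R]_n -> 'cV[R]_m -> 'cV[R]_n)
    (sigma : 'cV[R]_n -> 'cV[R]_m -> 'M[R]_(n, l))
    (rho : 'cV[R]_n -> 'cV[R]_m -> R) (gamma : R)
    (h : 'cV[R]_n -> R) (x : 'cV[R]_n) (u : 'cV[R]_m) : R :=
  dot (grad h x) (f x u)
  + 2^-1 * \tr ((sigma x u)^T *m hess h x *m sigma x u)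
  + rho x u - gamma * h x.

Definition hamiltonian_error (R : realType) n m l
    (f : 'cV[R]_n -> 'cV[R]_m -> 'cV[R]_n)
    (sigma : 'cV[R]_n -> 'cV[R]_m -> 'M[R]_(n, l)) (gamma : R)
    (delta : 'cV[R]_n -> R) (x : 'cV[R]_n) (u : 'cV[R]_m) : R :=
  dot (grad delta x) (f x u)
  + 2^-1 * \tr ((sigma x u)^T *m hess delta x *m sigma x u)
  - gamma * delta x.

Definition grad_rows (R : realType) n Nc (phi : 'cV[R]_n -> 'cV[R]_Nc)
    (x : 'cV[R]_n) : 'M[R]_(Nc, n) :=
  \matrix_(i, j) grad (fun y => phi y i 0) x j 0.

Definition data_vector (R : realType) n m l Nc
    (f : 'cV[R]_n -> 'cV[R]_m -> 'cV[R]_n)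
    (sigma : 'cV[R]_n -> 'cV[R]_m -> 'M[R]_(n, l)) (gamma : R)
    (phi : 'cV[R]_n -> 'cV[R]_Nc) (x : 'cV[R]_n) (u : 'cV[R]_m) :
    'cV[R]_Nc :=
  grad_rows phi x *m f x u
  + 2^-1 *: (\col_i \tr ((sigma x u)^T *m hess (fun y => phi y i 0) x
                                       *m sigma x u))
  - gamma *: phi x.

Definition filtration (R : realType) (d : measure_display)
    (T : measurableType d) (t0 : R) (F : R -> set (set T)) : Prop :=
  [/\ forall t, t0 <= t -> sigma_algebra [set: T] (F t),
      forall t, t0 <= t -> F t `<=` measurable &
      forall s t, t0 <= s -> s <= t -> F s `<=` F t].

Definition measurable_wrt (R : realType) (T : Type) (G : set (set T))
    (Z : T -> R) : Prop :=
  forall E : set R, measurable E -> G (Z @^-1` E).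

Definition continuous_adapted (R : realType) (T : Type) p (t0 : R)
    (F : R -> set (set T)) (X : R -> T -> 'cV[R]_p) : Prop :=
  (forall i w, {within `[t0, +oo[, continuous (fun t => X t w i 0)}) /\
  (forall t i, t0 <= t -> measurable_wrt (F t) (fun w => X t w i 0)).

Definition measurable_process (R : realType) (d : measure_display)
    (T : measurableType d) p (t0 : R) (X : R -> T -> 'cV[R]_p) : Prop :=
  forall i, measurable_fun (`[t0, +oo[ `*` [set: T])
    (fun z : R * T => X z.1 z.2 i 0).

(* Standard l-dimensional Brownian motion on [t0, +oo[ relative to F. The last
   clause says at once that B t - B s is independent of F s, and that its
   coordinates are independent and N(0, t - s)-distributed; the second
   parameter of [normal_prob] is the standard deviation. *)
Definition brownian_motion (R : realType) (d : measure_display)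
    (T : measurableType d) (P : probability T R) l (t0 : R)
    (F : R -> set (set T)) (B : R -> T -> 'cV[R]_l) : Prop :=
  [/\ continuous_adapted t0 F B,
      {ae P, forall w, B t0 w = 0} &
      forall s t, t0 <= s -> s < t ->
      forall (A : set T) (E : 'I_l -> set R), F s A ->
      (forall j, measurable (E j)) ->
      P (A `&` [set w | forall j, E j (B t w j 0 - B s w j 0)]) =
      (P A * \prod_(j < l) normal_prob 0%R (Num.sqrt (t - s)%R) (E j))%E].

Definition cvg_in_probability (R : realType) (d : measure_display)
    (T : measurableType d) (P : probability T R) (Z : nat -> T -> \bar R)
    (Y : T -> \bar R) : Prop :=
  forall e : R, 0 < e ->
  P [set w | (e%:E <= `|Z q w - Y w|)%E] @[q --> \oo] --> 0%E.

(* The simple process \sum_(k < N) xi k * \1_(]p k, p k.+1]) on [a, b]. *)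
Definition simple_process (R : realType) (T : Type) (F : R -> set (set T))
    (a b : R) (N : nat) (p : nat -> R) (xi : nat -> T -> R) : Prop :=
  [/\ p 0%N = a, p N = b,
      forall k, (k < N)%N -> p k <= p k.+1,
      forall k, (k < N)%N -> measurable_wrt (F (p k)) (xi k) &
      forall k, (k < N)%N -> exists C : R, forall w, `|xi k w| <= C].

Definition simple_val (R : realType) (T : Type) (N : nat) (p : nat -> R)
    (xi : nat -> T -> R) (r : R) (w : T) : R :=
  \sum_(k < N) xi k w * \1_(`]p k, p k.+1]) r.

Definition simple_int (R : realType) (T : Type) (N : nat) (p : nat -> R)
    (xi : nat -> T -> R) (b : R -> T -> R) (w : T) : R :=
  \sum_(k < N) xi k w * (b (p k.+1) w - b (p k) w).

(* I is (a version of) the Ito integral of H against the scalar Brownian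
   motion b over [s, t]: the limit in probability of the integrals of simple
   adapted processes that converge to H in L^2(ds), in probability. *)
Definition ito_integral (R : realType) (d : measure_display)
    (T : measurableType d) (P : probability T R) (F : R -> set (set T))
    (b : R -> T -> R) (s t : R) (H : R -> T -> R) (I : T -> R) : Prop :=
  measurable_fun [set: T] I /\
  exists (N : nat -> nat) (p : nat -> nat -> R) (xi : nat -> nat -> T -> R),
  [/\ forall q, simple_process F s t (N q) (p q) (xi q),
      cvg_in_probability P
        (fun q w => \int[lebesgue_measure]_(r in `[s, t])
           ((simple_val (N q) (p q) (xi q) r w - H r w) ^+ 2)%:E)%E
        (fun=> 0%E) &
      cvg_in_probability P
        (fun q w => (simple_int (N q) (p q) (xi q) b w)%:E)
        (fun w => (I w)%:E)].

(* X solves dX_t = drift(X_t) dt + diff(X_t) dB_t on [t0, +oo[. *)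
Definition sde_solution (R : realType) (d : measure_display)
    (T : measurableType d) (P : probability T R) n l (t0 : R)
    (F : R -> set (set T)) (B : R -> T -> 'cV[R]_l)
    (drift : 'cV[R]_n -> 'cV[R]_n) (diff : 'cV[R]_n -> 'M[R]_(n, l))
    (X : R -> T -> 'cV[R]_n) : Prop :=
  continuous_adapted t0 F X /\
  forall t, t0 <= t ->
  exists I : 'I_n -> 'I_l -> T -> R,
  (forall i j, ito_integral P F (fun r w => B r w j 0) t0 t
     (fun r w => diff (X r w) i j) (I i j)) /\
  {ae P, forall w, forall i,
     lebesgue_measure.-integrable `[t0, t]
       (fun r => (drift (X r w) i 0)%:E) /\
     X t w i 0 = X t0 w i 0
       + \int[lebesgue_measure]_(r in `[t0, t]) (drift (X r w) i 0)
       + \sum_(j < l) I i j w}.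

(* j = J^kappa(x0). Conditioning on X_0 = x0 means starting the closed loop at
   x0. The disjunction excludes the costs of the form oo - oo only; j may be
   infinite. *)
Definition policy_cost (R : realType) (d : measure_display)
    (T : measurableType d) (P : probability T R) n m l
    (F : R -> set (set T)) (B : R -> T -> 'cV[R]_l)
    (f : 'cV[R]_n -> 'cV[R]_m -> 'cV[R]_n)
    (sigma : 'cV[R]_n -> 'cV[R]_m -> 'M[R]_(n, l))
    (rho : 'cV[R]_n -> 'cV[R]_m -> R) (gamma : R)
    (kappa : 'cV[R]_n -> 'cV[R]_m) (x0 : 'cV[R]_n) (j : \bar R) : Prop :=
  borel_fun kappa /\
  exists X : R -> T -> 'cV[R]_n,
  let c := fun w t => (expR (- (gamma * t)) * rho (X t w) (kappa (X t w)))%:E in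
  [/\ sde_solution P 0 F B (fun x => f x (kappa x))
        (fun x => sigma x (kappa x)) X,
      {ae P, forall w, X 0 w = x0},
      (\int[P]_w \int[lebesgue_measure]_(t in `[0%R, +oo[) (c w)^\+ t < +oo)%E \/
      (\int[P]_w \int[lebesgue_measure]_(t in `[0%R, +oo[) (c w)^\- t < +oo)%E &
      j = (\int[P]_w \int[lebesgue_measure]_(t in `[0%R, +oo[) c w t)%E].

(* V = min_kappa J^kappa, pointwise. *)
Definition value_function (R : realType) (d : measure_display)
    (T : measurableType d) (P : probability T R) n m l
    (F : R -> set (set T)) (B : R -> T -> 'cV[R]_l)
    (f : 'cV[R]_n -> 'cV[R]_m -> 'cV[R]_n)
    (sigma : 'cV[R]_n -> 'cV[R]_m -> 'M[R]_(n, l))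
    (rho : 'cV[R]_n -> 'cV[R]_m -> R) (gamma : R)
    (V : 'cV[R]_n -> R) : Prop :=
  forall x0,
  let costs :=
    [set j | exists kappa, policy_cost P F B f sigma rho gamma kappa x0 j] in
  costs (V x0)%:E /\ lbound costs (V x0)%:E.

(* [tk t k] is the k-th sampling time of the replay buffer used at time t. The
   critic learns from time 0 on; samples may stem from the whole observation
   period [t0, +oo[, t0 <= 0, so that for t0 < 0 the M distinct samples required
   can be available at time 0 already. *)
Definition replay_times (R : realType) M (t0 : R) (tk : R -> 'I_M -> R) :
    Prop :=
  (forall k, measurable_fun (`[0, +oo[ : set R) (tk ^~ k)) /\
  forall t, 0 <= t ->
  [/\ forall k, t0 <= tk t k,
      forall k k' : 'I_M, (k < k')%N -> tk t k < tk t k' &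
      forall k : 'I_M, k.+1 = M -> tk t k = t].

(* The matrix E_t, for the data vectors W_1, ..., W_M in the buffer. *)
Definition excitation (R : realType) Nc M (W : 'I_M -> 'cV[R]_Nc) :
    'M[R]_Nc :=
  \sum_(k < M) (dot (W k) (W k) + 1) ^- 2 *: (W k *m (W k)^T).

(* Main.v *)
Require Import Defs.
From HB Require Import structures.
From mathcomp Require Import all_boot all_order all_algebra.
From mathcomp Require Import all_classical all_reals all_analysis.
From mathcomp Require Import measurable_realfun.
From mathcomp Require Import ring lra.

Set Implicit Arguments.
Unset Strict Implicit.
Unset Printing Implicit Defensive.

Import Order.TTheory GRing.Theory Num.Theory.
Import numFieldNormedType.Exports.

Local Open Scope classical_set_scope.
Local Open Scope ring_scope.

(** The Hamiltonian depends on the value function through the linear operator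
    [hamiltonian_error], and this operator maps the i-th feature to the i-th
    entry of the data vector w. Since V is theta_star . phi + delta, the
    unknown terms therefore cancel ([hamiltonian_residual]):
      H(x, u | V) - delta_H(x, u) = theta_star . w(x, u) + rho(x, u).
    Because |w| and |w|^2 are at most (|w|^2 + 1)^2, each summand of the
    residual is then at most |z| (|theta_star| + |rho|), where z is the weight
    error ([residual_term_bound]). Together with the excitation bound this
    gives, with c = alpha eps and Z = |z|^2,
      dZ/dt <= - c Z + q,   q = alpha |z| sum_k (b + C |X_(t_k)|^2).

    Along a path, multiplying by the integrating factor e^(ct) yields
      e^(ct) Z_t <= Z_0 + int_0^t e^(cs) q_s ds   ([pathwise_gronwall]).
    As Z is only the primitive of an integrable function, the product rule is
    replaced by Fubini's theorem on the triangle r <= s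
    ([integral_weighted_primitive]). Taking expectations and exchanging the
    integrals by Tonelli's theorem ([expected_gronwall]), it remains to bound
    E[q_s]. By the Cauchy-Schwarz inequality and the fourth moments of X,
      E[q_s] <= alpha M K1 sqrt(E[Z_s]),
    and int_0^t c e^(cs) ds <= e^(ct) gives the claim with D = M K1 / eps.

    The exchange of integrals, and the passage from excitation at each time
    almost surely to excitation along almost every path at almost every time
    ([ae_swap]), need the data (s, w) |-> X_(t_k(s))(w) to be jointly
    measurable. X has continuous paths, hence is the limit of its
    discretisations in time ([measurable_sampled_process]); the data vector is
    a Borel function of the state, which requires in particular that functions
    with continuous partial derivatives are continuous ([C1_continuous]). *)

(** * Euclidean geometry of the weights *)

Section dot.
Variables (R : realType) (p : nat).
Implicit Types u v : 'cV[R]_p.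

Lemma dotE u v : dot u v = \sum_i u i 0 * v i 0.
Proof. by rewrite /dot mxE; apply: eq_bigr => i _; rewrite mxE. Qed.

Lemma enormE u : enorm u ^+ 2 = dot u u.
Proof.
rewrite sqr_sqrtr; last by do 2![apply: sumr_ge0 => ? _]; exact: sqr_ge0.
by rewrite dotE; apply: eq_bigr => i _; rewrite big_ord1 expr2.
Qed.

Lemma dotDZl (a : R) u u' v : dot (u + a *: u') v = dot u v + a * dot u' v.
Proof.
rewrite !dotE mulr_sumr -big_split /=; apply: eq_bigr => i _.
by rewrite !mxE; ring.
Qed.

Lemma enorm_ge0 u : 0 <= enorm u. Proof. exact: sqrtr_ge0. Qed.

Lemma dot_cauchy_schwarz u v : `|dot u v| <= enorm u * enorm v.
Proof.
rewrite -ler_sqr ?nnegrE ?mulr_ge0 ?enorm_ge0// exprMn !enormE.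
rewrite real_normK ?num_real//.
(* |a u + b v|^2 is nonnegative; (a, b) is chosen below such that this is the
   claim times dot v v or times dot u u, the last two choices covering the
   case that both vanish. *)
have quad (a b : R) :
    0 <= a ^+ 2 * dot u u + 2 * (a * b) * dot u v + b ^+ 2 * dot v v.
  rewrite !dotE !mulr_sumr -!big_split /=; apply: sumr_ge0 => i _.
  by rewrite (_ : _ + _ = (a * u i 0 + b * v i 0) ^+ 2) ?sqr_ge0//; ring.
have := quad (dot v v) (- dot u v).
have := quad (dot u v) (- dot u u).
have := quad 1 (- dot u v); have := quad (- dot u v) 1.
have : 0 <= dot u u by rewrite -enormE sqr_ge0.
have : 0 <= dot v v by rewrite -enormE sqr_ge0.
set a := dot u u; set b := dot u v; set c := dot v v => c0 a0.
have [->|cn0] := eqVneq c 0; last first.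
  move=> _ _ _; rewrite -(@ler_pM2l _ c) ?lt_def ?cn0//.
  by move=> h; rewrite -subr_ge0; move: h; congr (0 <= _); ring.
have [->|an0] := eqVneq a 0; first by move=> + + _ _; nra.
move=> _ _ + _; rewrite -(@ler_pM2l _ a) ?lt_def ?an0//.
by move=> h; rewrite -subr_ge0; move: h; congr (0 <= _); ring.
Qed.

Lemma loewner_ge_quad (A : 'M[R]_p) (e : R) v :
  loewner_ge A e%:M -> e * enorm v ^+ 2 <= dot v (A *m v).
Proof.
move=> [_ /(_ v)]; rewrite mulmxBl mul_scalar_mx /dot mulmxBr -scalemxAr.
by rewrite mxE [X in _ + X]mxE [X in - X]mxE subr_ge0 enormE.
Qed.

(** The denominator absorbs w: with a = |w|, the numerator is at most
    |z| (|s| a^2 + a |r|), and both a and a^2 are at most (a^2 + 1)^2. *)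
Lemma residual_term_bound (z w s : 'cV[R]_p) (r : R) :
  `|dot z w * (dot s w + r) / (dot w w + 1) ^+ 2| <=
  enorm z * (enorm s + `|r|).
Proof.
have ww : 0 <= dot w w by rewrite -enormE sqr_ge0.
rewrite normrM normrM normfV (ger0_norm (sqr_ge0 _)).
rewrite ler_pdivrMr ?exprn_gt0 ?ltr_wpDl//.
have zw := dot_cauchy_schwarz z w; have sw := dot_cauchy_schwarz s w.
have le1 : `|dot s w + r| <= enorm s * enorm w + `|r|.
  by rewrite (le_trans (ler_normD _ _))// lerD2r.
apply: (le_trans (ler_pM _ _ zw le1)) => //.
rewrite -!mulrA ler_wpM2l ?enorm_ge0// -enormE mulrDr.
have := enorm_ge0 w; set a := enorm w => a0.
rewrite mulrDl; apply: lerD.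
  by rewrite mulrCA ler_wpM2l ?enorm_ge0//; nra.
by rewrite mulrC ler_wpM2l//; nra.
Qed.

End dot.

(** * Functions with continuous partial derivatives *)

Lemma is_derive_along (R : realType) n (h : 'cV[R]_n -> R) (p v : 'cV[R]_n)
    (s : R) : derivable h (p + s *: v) v ->
  is_derive s (1 : R) (fun r : R => h (p + r *: v)) ('D_v h (p + s *: v)).
Proof.
move=> dh.
have quotE : (fun t : R => t^-1 *: (((fun r : R => h (p + r *: v)) \o shift s)
    (t *: 1) - h (p + s *: v))) =
  (fun t : R => t^-1 *: ((h \o shift (p + s *: v)) (t *: v) - h (p + s *: v))).
  apply/funext => t /=; congr (_ *: (h _ - _)).
  by rewrite [t *: 1]mulr1 scalerDl addrCA.
apply: DeriveDef; first by rewrite /derivable quotE.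
by rewrite /derive quotE.
Qed.

(** The mean value theorem along the i-th coordinate. The condition
    [0 <= s * a] restricts s to the segment between 0 and a, whatever the sign
    of a. *)
Lemma coordinate_step (R : realType) n (h : 'cV[R]_n -> R) (i : 'I_n)
    (p : 'cV[R]_n) (a K : R) :
  (forall x, derivable h x (delta_mx i 0 : 'cV[R]_n)) ->
  (forall s, `|s| <= `|a| -> 0 <= s * a ->
     `|partial i h (p + s *: delta_mx i 0)| <= K) ->
  `|h (p + a *: delta_mx i 0) - h p| <= K * `|a|.
Proof.
move=> dh bK; pose g (r : R) := h (p + r *: delta_mx i 0).
have dg (s : R) : is_derive s (1 : R) g (partial i h (p + s *: delta_mx i 0)).
  exact: is_derive_along.
have cg (I : set R) : {within I, continuous g}.
  apply: continuous_subspaceT => s; apply: differentiable_continuous.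
  by apply/derivable1_diffP; exact: (@ex_derive _ _ _ _ _ _ _ (dg s)).
have -> : h p = g 0 by rewrite /g scale0r addr0.
rewrite -/(g a); have [a0|a0] := leP 0 a.
  have [c] := MVT_segment a0 (fun x _ => dg x) (cg _).
  rewrite in_itv /= => /andP[c0 ca] ->; rewrite subr0 normrM ler_wpM2r//.
  by apply: bK; [rewrite !ger0_norm|rewrite mulr_ge0].
have [c] := MVT_segment (ltW a0) (fun x _ => dg x) (cg _).
rewrite in_itv /= => /andP[ca c0]; rewrite distrC => ->.
rewrite sub0r normrM normrN ler_wpM2r//.
apply: bK; last by rewrite nmulr_lge0.
by rewrite !ler0_norm ?lerN2// ltW.
Qed.

(** Near x the partial derivatives are bounded by some K. Going from x to y by
    changing one coordinate at a time stays in the max-norm ball around x, so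
    that h changes by at most the sum of the K |y_i - x_i|. *)
Lemma C1_continuous (R : realType) n (h : 'cV[R]_n -> R) :
  (forall i x, derivable h x (delta_mx i 0 : 'cV[R]_n)) ->
  (forall i, continuous (partial i h)) -> continuous h.
Proof.
move=> dh cp x.
pose K := 1 + \sum_i `|partial i h x|.
have K0 : 0 < K by rewrite ltr_pwDl// sumr_ge0.
have : \forall y \near x, forall i, `|partial i h y| <= K.
  apply: (filter_forall (F := nbhs x)) => i.
  have /cvgrPdist_le/(_ _ ltr01) := cp i x.
  apply: filterS => y; rewrite distrC => hy.
  rewrite -[partial i h y](subrK (partial i h x)).
  rewrite (le_trans (ler_normD _ _))// lerD// (bigD1 i)//= lerDl.
  by rewrite sumr_ge0.
move=> /nbhs_ballP[r /= r0 br].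
have lip y : ball x r y -> `|h x - h y| <= \sum_(i < n) K * `|y i 0 - x i 0|.
  (* p k has the first k coordinates of y and the other ones of x. *)
  move=> xy; pose p k : 'cV[R]_n := \col_i (if (i < k)%N then y i 0 else x i 0).
  have -> : h x = h (p 0%N).
    by congr h; apply/matrixP => i j; rewrite !mxE ord1.
  have -> : h y = h (p n).
    by congr h; apply/matrixP => i j; rewrite !mxE ord1 ltn_ord.
  rewrite distrC -(telescope_sumr (fun k => h (p k)))// big_mkord.
  rewrite (le_trans (ler_norm_sum _ _ _))// ler_sum// => k _.
  have -> : p k.+1 = p k + (y k 0 - x k 0) *: delta_mx k 0.
    apply/matrixP => i j; rewrite !mxE ord1 eqxx andbT ltnS leq_eqVlt.
    have [->|ik] := eqVneq i k; first by rewrite ltnn eqxx /= mulr1 subrKC.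
    by rewrite (negbTE (ik : (i != k :> nat))) /= mulr0 addr0.
  apply: coordinate_step => // s sa s0; apply: br; split => // i j.
  have := xy.2 i j; rewrite !mxE ord1 eqxx andbT /ball /=.
  have [->|ik] := eqVneq i k; last first.
    by rewrite mulr0 addr0; case: ifP => // _ _; rewrite subrr normr0.
  rewrite ltnn mulr1 opprD addrA subrr sub0r normrN distrC => h1.
  exact: le_lt_trans h1.
suff near_h (e : R) : 0 < e -> \forall y \near x, `|h x - h y| <= e.
  by apply/(@cvgrPdist_le _ _ _ (nbhs x)) => e /near_h.
move=> e0.
have de : 0 < e / (K * n.+1%:R) by rewrite divr_gt0// mulr_gt0.
near=> y.
have xr : ball x r y by near: y; exact: nbhsx_ballx.
apply: (le_trans (lip _ xr)).
have xe : ball x (e / (K * n.+1%:R)) y by near: y; apply: nbhsx_ballx.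
apply: (@le_trans _ _ (\sum_(i < n) e / n.+1%:R)).
  apply: ler_sum => i _; rewrite mulrC -ler_pdivlMr// -mulrA -invfM.
  by rewrite (mulrC _ K) distrC ltW//; exact: xe.2.
rewrite sumr_const card_ord -[leLHS]mulr_natr -mulrA ler_piMr// ?ltW//.
by rewrite ltr_pdivrMl// mulr1 ltr_nat.
Unshelve. all: by end_near. Qed.

Lemma C2_continuous (R : realType) n (h : 'cV[R]_n -> R) : C2 h -> continuous h.
Proof. by case=> d1 c1 _ _; exact: C1_continuous. Qed.

Lemma partialDZ (R : realType) n (i : 'I_n) (h g : 'cV[R]_n -> R) (a : R) x :
  derivable h x (delta_mx i 0 : 'cV[R]_n) ->
  derivable g x (delta_mx i 0 : 'cV[R]_n) ->
  partial i (fun y => h y + a * g y) x = partial i h x + a * partial i g x.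
Proof.
move=> dh dg; have dag := derivableZ (k := a) dg.
rewrite /partial [LHS](_ : _ = 'D_(delta_mx i 0) (h + a \*: g) x)//.
by rewrite (deriveD dh dag) (deriveZ _ dg).
Qed.

Lemma derivableDZ (R : realType) n (h g : 'cV[R]_n -> R) (a : R) x v :
  derivable h x v -> derivable g x v -> derivable (fun y => h y + a * g y) x v.
Proof.
by move=> dh dg; exact: (derivableD dh (derivableZ (k := a) dg)).
Qed.

Lemma C2_partialDZ (R : realType) n (i : 'I_n) (h g : 'cV[R]_n -> R) (a : R) :
  C2 h -> C2 g ->
  partial i (fun y => h y + a * g y) =
  (fun y => partial i h y + a * partial i g y).
Proof.
by move=> [dh _ _ _] [dg _ _ _]; apply/funext => x; exact: partialDZ.
Qed.

Lemma C2_hessDZ (R : realType) n (i j : 'I_n) (h g : 'cV[R]_n -> R) (a : R) :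
  C2 h -> C2 g ->
  partial i (partial j (fun y => h y + a * g y)) =
  (fun y => partial i (partial j h) y + a * partial i (partial j g) y).
Proof.
move=> Ch Cg; rewrite C2_partialDZ//; apply/funext => x.
by case: Ch Cg => [_ _ d2h _] [_ _ d2g _]; apply: partialDZ.
Qed.

Lemma C2DZ (R : realType) n (h g : 'cV[R]_n -> R) (a : R) :
  C2 h -> C2 g -> C2 (fun y => h y + a * g y).
Proof.
move=> Ch Cg; have [dh ch d2h c2h] := Ch; have [dg cg d2g c2g] := Cg.
split => [i x|i|i j x|i j].
- exact: derivableDZ.
- by rewrite C2_partialDZ// => x;
  exact: (cvgD (ch i x) (cvgMl_tmp (a := a) (cg i x))).
- by rewrite C2_partialDZ//; exact: derivableDZ.
- by rewrite C2_hessDZ// => x;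
  exact: (cvgD (c2h i j x) (cvgMl_tmp (a := a) (c2g i j x))).
Qed.

(** * Linearity of the generator *)

Section generator.
Variables (R : realType) (n m l : nat).
Variables (f : 'cV[R]_n -> 'cV[R]_m -> 'cV[R]_n).
Variables (sigma : 'cV[R]_n -> 'cV[R]_m -> 'M[R]_(n, l)) (gamma : R).
Local Notation L := (hamiltonian_error f sigma gamma).

Lemma generatorDZ (h g : 'cV[R]_n -> R) (a : R) x u : C2 h -> C2 g ->
  L (fun y => h y + a * g y) x u = L h x u + a * L g x u.
Proof.
move=> Ch Cg; rewrite /hamiltonian_error.
have -> : grad (fun y => h y + a * g y) x = grad h x + a *: grad g x.
  by apply/matrixP => i j; rewrite !mxE C2_partialDZ.
have -> : hess (fun y => h y + a * g y) x = hess h x + a *: hess g x.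
  by apply/matrixP => i j; rewrite !mxE C2_hessDZ.
rewrite dotDZl mulmxDr -scalemxAr mulmxDl -scalemxAl mxtraceD mxtraceZ.
(* Stated for variables, so that [ring] does not try to identify different
   derivatives by unfolding them. *)
have alg (A A' D D' H H' : R) : A + a * A' + 2^-1 * (D + a * D')
    - gamma * (H + a * H') =
    A + 2^-1 * D - gamma * H + a * (A' + 2^-1 * D' - gamma * H') by ring.
exact: alg.
Qed.

Lemma data_vectorE Nc (phi : 'cV[R]_n -> 'cV[R]_Nc) x u i :
  data_vector f sigma gamma phi x u i 0 = L (fun y => phi y i 0) x u.
Proof.
rewrite /data_vector /hamiltonian_error !mxE; congr (_ + _ - _).
by rewrite /dot !mxE; apply: eq_bigr => j _; rewrite !mxE.
Qed.

(** Subtracting the weighted features from V one at a time ends at delta, and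
    each step lowers the generator of the remainder by one weighted entry of
    the data vector. The induction carries [C2] along, because the linearity of
    the generator rests on it. *)
Lemma hamiltonian_residual Nc (rho : 'cV[R]_n -> 'cV[R]_m -> R)
    (V delta : 'cV[R]_n -> R) (phi : 'cV[R]_n -> 'cV[R]_Nc) (theta : 'cV[R]_Nc)
    x u :
  C2 V -> (forall i, C2 (fun y => phi y i 0)) ->
  (forall y, V y = dot theta (phi y) + delta y) ->
  hamiltonian f sigma rho gamma V x u - L delta x u =
  dot theta (data_vector f sigma gamma phi x u) + rho x u.
Proof.
move=> CV Cphi VE.
pose part s y := V y - \sum_(i <- s) theta i 0 * phi y i 0.
have H s : C2 (part s) /\
    L (part s) x u = L V x u
      - \sum_(i <- s) theta i 0 * data_vector f sigma gamma phi x u i 0.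
  elim: s => [|i s [Cs Ls]].
    have -> : part [::] = V by apply/funext => y; rewrite /part big_nil subr0.
    by rewrite big_nil subr0.
  have -> : part (i :: s) = (fun y => part s y + - theta i 0 * phi y i 0).
    by apply/funext => y; rewrite /part big_cons; ring.
  split; first exact: (C2DZ (- theta i 0) Cs (Cphi i)).
  have alg (a b c e : R) : a - b + - c * e = a - (c * e + b) by ring.
  rewrite (generatorDZ (- theta i 0) x u Cs (Cphi i)) Ls -data_vectorE big_cons.
  exact: alg.
have dE : delta = part (index_enum 'I_Nc).
  apply/funext => y; rewrite /part VE /dot !mxE.
  by under eq_bigr do rewrite mxE; ring.
rewrite dE (H _).2 /dot mxE; under [in RHS]eq_bigr do rewrite mxE.
have alg (a b c e S : R) : a + b + c - e - (a + b - e - S) = S + c by ring.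
exact: alg.
Qed.

End generator.

(** * Borel measurability of vector-valued functions *)

Section borel_vectors.
Variables (R : realType) (n : nat).

Lemma open_bigcup_rational_box (O : set 'cV[R]_n) : open O ->
  O = \bigcup_(q in [set q : 'cV[rat]_n * nat |
         [set y : 'cV[R]_n | forall i, `|y i 0 - ratr (q.1 i 0)| < q.2.+1%:R^-1]
         `<=` O])
      [set y : 'cV[R]_n | forall i, `|y i 0 - ratr (q.1 i 0)| < q.2.+1%:R^-1].
Proof.
move=> oO; apply/seteqP; split => [y Oy|y [q qO yq]]; last exact: qO.
have /nbhs_ballP[r /= r0 rO] : nbhs y O by exact: open_nbhs_nbhs.
pose k := Num.truncn (2 / r).
have kr : k.+1%:R^-1 < r / 2.
  rewrite -[r / 2]invrK ltf_pV2 ?posrE ?invr_gt0 ?divr_gt0//.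
  by rewrite invfM invrK mulrC; exact: truncnS_gt.
have /choice[a ya] (i : 'I_n) :
    exists a : rat, `|y i 0 - ratr a| < k.+1%:R^-1 :> R.
  have : y i 0 - k.+1%:R^-1 < y i 0 + k.+1%:R^-1 by rewrite ltrD2l gtrN.
  move=> /rat_in_itvoo[a]; rewrite in_itv /= => ?; exists a.
  by rewrite distrC ltr_distl.
exists (\col_i a i, k); last by move=> i /=; rewrite mxE.
move=> z /= zq; apply: rO; split => // i j; rewrite ord1 /ball /=.
have := zq i; rewrite mxE => zi; rewrite -(subrK (ratr (a i)) (y i 0)) -addrA.
rewrite (le_lt_trans (ler_normD _ _))// (splitr r).
by rewrite ltrD// (lt_trans _ kr)// distrC.
Qed.

(** The Borel sigma-algebra of the vectors is generated by the coordinates,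
    because an open set is a countable union of rational boxes. *)
Lemma measurable_fun_borel_cV d (S : measurableType d) (h : S -> 'cV[R]_n) :
  (forall i, measurable_fun [set: S] (fun x => h x i 0)) ->
  measurable_fun [set: S] (h : S -> borel_cV R n).
Proof.
move=> mh; apply: (measurability (rT := borel_cV R n) (@open 'cV[R]_n) erefl).
move=> _ [A oA <-]; rewrite setTI (open_bigcup_rational_box oA).
(* The union over all boxes, those outside of A being replaced by the empty
   set, is indexed by a countable type. *)
rewrite preimage_bigcup bigcup_mkcond.
apply: countable_bigcupT_measurable => // q; case: ifPn => // _.
rewrite (_ : _ @^-1` _ = \bigcap_(i in [set: 'I_n])
    ((fun x => h x i 0) @^-1` ball (ratr (q.1 i 0) : R) q.2.+1%:R^-1)).
  apply: fin_bigcap_measurable => // i _.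
  by rewrite -[X in measurable X]setTI; exact: mh (measurable_ball _ _).
apply/seteqP; split => [x /= hx i _|x /= hx i].
  by rewrite /ball /= distrC; exact: hx.
by have := hx i Logic.I; rewrite /ball /= distrC.
Qed.

Lemma continuous_borel_cV (h : 'cV[R]_n -> R) : continuous h ->
  measurable_fun [set: borel_cV R n] (h : borel_cV R n -> R).
Proof.
move=> /continuousP ch; apply: (measurability _ (RGenOpens.measurableE R)).
move=> _ [_ [a [b ->] <-]]; rewrite setTI; apply: sub_sigma_algebra.
exact/ch/interval_open.
Qed.

End borel_vectors.

(** * Joint measurability of a continuous process sampled at variable times *)

Section continuous_process.
Context (R : realType) (d : measure_display) (T : measurableType d).
Context (d' : measure_display) (S : measurableType d').

(** The sampling time s x is approximated from below by points of the grid of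
    mesh 1/(q+1) starting at t0. For fixed q, the level sets of the
    approximation are countably many, and on each of them the sampled process
    is a measurable function of w alone; continuity of the paths gives the
    limit in q. *)
Lemma measurable_sampled_process (X : R -> T -> R) (t0 : R) (s : S -> R) :
  (forall w, {within `[t0, +oo[, continuous (X ^~ w)}) ->
  (forall t, t0 <= t -> measurable_fun [set: T] (X t)) ->
  measurable_fun [set: S] s -> (forall x, t0 <= s x) ->
  measurable_fun [set: S * T] (fun z => X (s z.1) z.2).
Proof.
move=> cX mX ms s0.
pose k q x := Num.truncn ((s x - t0) * q.+1%:R).
pose tau q j : R := t0 + j%:R / q.+1%:R.
have sq0 q x : 0 <= (s x - t0) * q.+1%:R by rewrite mulr_ge0// subr_ge0.
apply: (measurable_fun_cvg (h := fun q z => X (tau q (k q z.1)) z.2)).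
  move=> q _ Y mY; rewrite setTI.
  rewrite (_ : _ @^-1` _ = \bigcup_j
     ((k q @^-1` [set j]) `*` (X (tau q j) @^-1` Y))); last first.
    apply/seteqP; split => [[x w] /= Yx|[x w] [j _] [/= <-]//].
    by exists (k q x).
  apply: bigcupT_measurable => j; apply: measurableX; last first.
    rewrite -[X in measurable X]setTI; apply: mX => //.
    by rewrite lerDl divr_ge0.
  rewrite (_ : _ @^-1` _ =
     setT `&` (fun x => (s x - t0) * q.+1%:R) @^-1` `[j%:R, j.+1%:R[).
    by apply: measurable_funM => //; exact: measurable_funB.
  rewrite setTI; apply/seteqP; split => x /=.
    by move=> kx; rewrite in_itv /= -truncn_eq//; exact/eqP.
  by rewrite in_itv /= -truncn_eq// => /eqP.
move=> [x w] _ /=.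
have tau0 q j : t0 <= tau q j by rewrite lerDl divr_ge0.
have taus : tau q (k q x) @[q --> \oo] --> s x.
  apply/cvgrPdist_lt => e e0; near=> q.
  have := truncn_itv (sq0 q x); rewrite -/(k q x) => /andP[k1 k2].
  have q0 : (0 : R) < q.+1%:R by [].
  rewrite /tau opprD addrA ger0_norm; last by rewrite subr_ge0 ler_pdivrMr.
  apply: (@lt_trans _ _ q.+1%:R^-1); last first.
    by near: q; exact: (near_infty_natSinv_lt (PosNum e0)).
  rewrite ltrBlDr -(ltr_pM2r q0) [ltRHS]mulrDl divfK ?gt_eqF// mulVf ?gt_eqF//.
  by rewrite nat1r.
have /subspace_continuousP/(_ (s x)) := cX w.
rewrite /= in_itv /= andbT => /(_ (s0 x)); apply: cvg_comp => Y /= nY.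
apply: (filterS (F := \oo) _ (taus _ nY)) => q /=; apply.
by rewrite in_itv /= andbT; exact: tau0.
Unshelve. all: by end_near. Qed.

End continuous_process.

(** * Borel measurability of the data vectors *)

Section vector_measurability.
Context (R : realType) (d : measure_display) (S : measurableType d) (p : nat).
Implicit Types u v : S -> 'cV[R]_p.

Lemma measurable_dot u v :
  (forall i, measurable_fun [set: S] (fun x => u x i 0)) ->
  (forall i, measurable_fun [set: S] (fun x => v x i 0)) ->
  measurable_fun [set: S] (fun x => dot (u x) (v x)).
Proof.
move=> mu mv; under eq_fun do rewrite dotE.
by apply: measurable_sum => i; exact: measurable_funM.
Qed.

Lemma measurable_enorm u :
  (forall i, measurable_fun [set: S] (fun x => u x i 0)) ->
  measurable_fun [set: S] (fun x => enorm (u x)).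
Proof.
move=> mu; rewrite (_ : (fun x => _) = (fun x => Num.sqrt (dot (u x) (u x)))).
  apply: measurableT_comp; last exact: measurable_dot.
  by apply: continuous_measurable_fun; exact: sqrt_continuous.
by apply/funext => x; rewrite -enormE sqrtr_sqr ger0_norm// enorm_ge0.
Qed.

Lemma excitation_quad M (W : 'I_M -> 'cV[R]_p) (v : 'cV[R]_p) :
  dot v (excitation W *m v) =
  \sum_k dot v (W k) ^+ 2 * (dot (W k) (W k) + 1)^-1 ^+ 2.
Proof.
have quad1 w : dot v (w *m w^T *m v) = dot v w ^+ 2.
  rewrite {1}/dot -mulmxA mulmxA (mx11_scalar (w^T *m v)) mul_mx_scalar mxE.
  rewrite expr2 -/(dot w v) -/(dot v w); congr (_ * _).
  by rewrite !dotE; apply: eq_bigr => i _; rewrite mulrC.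
rewrite /excitation mulmx_suml /dot mulmx_sumr summxE; apply: eq_bigr => k _.
rewrite -scalemxAl -scalemxAr [LHS]mxE -!/(dot _ _) quad1 mulrC.
by rewrite -exprVn.
Qed.

Lemma measurable_excitation_quad M (W : S -> 'I_M -> 'cV[R]_p) v :
  (forall k i, measurable_fun [set: S] (fun x => W x k i 0)) ->
  (forall i, measurable_fun [set: S] (fun x => v x i 0)) ->
  measurable_fun [set: S] (fun x => dot (v x) (excitation (W x) *m v x)).
Proof.
move=> mW mv; under eq_fun do rewrite excitation_quad.
apply: measurable_sum => k; apply: measurable_funM.
  by apply: measurable_funX; exact: measurable_dot.
apply: measurable_funX.
(* The inverse is measurable because |y| + 1 stays away from 0; the absolute
   value does not change y = dot W W, which is nonnegative. *)
have cinv : continuous (fun y : R => (`|y| + 1)^-1).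
  move=> y; apply: (@cvgV _ _ _ _ (fun y : R => `|y| + 1)).
    by rewrite gt_eqF// ltr_wpDl.
  by apply: cvgD; [exact: norm_continuous|exact: cvg_cst].
rewrite (_ : (fun x => _) = (fun y : R => (`|y| + 1)^-1)
    \o (fun x => dot (W x k) (W x k))).
  apply: measurableT_comp; first exact: continuous_measurable_fun.
  exact: measurable_dot.
by apply/funext => x /=; rewrite ger0_norm// -enormE sqr_ge0.
Qed.

End vector_measurability.

Section closed_loop.
Variables (R : realType) (n m l : nat) (mu : 'cV[R]_n -> 'cV[R]_m).
Hypothesis bmu : borel_fun mu.

Lemma borel_closed_loop p q (h : 'cV[R]_n -> 'cV[R]_m -> 'M[R]_(p, q)) :
  borel_fun2 h -> borel_fun (fun x => h x (mu x)).
Proof.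
move=> bh i j; apply: (measurableT_comp (bh i j)
  (g := fun x : borel_cV R n => (x : borel_cV R n, mu x : borel_cV R m))).
apply: measurable_fun_pair; first exact: measurable_id.
exact: (measurable_fun_borel_cV (S := borel_cV R n)).
Qed.

Variables (f : 'cV[R]_n -> 'cV[R]_m -> 'cV[R]_n).
Variables (sigma : 'cV[R]_n -> 'cV[R]_m -> 'M[R]_(n, l)) (gamma : R).
Hypotheses (bf : borel_fun2 f) (bsigma : borel_fun2 sigma).

Lemma borel_generator (h : 'cV[R]_n -> R) : C2 h ->
  measurable_fun [set: borel_cV R n]
    (fun x : borel_cV R n => hamiltonian_error f sigma gamma h x (mu x) : R).
Proof.
move=> Ch; have [_ cp _ cpp] := Ch; rewrite /hamiltonian_error.
have bfm := borel_closed_loop bf; have bsm := borel_closed_loop bsigma.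
apply: measurable_funB; last first.
  apply: measurable_funM => //.
  exact: (continuous_borel_cV (C2_continuous Ch)).
apply: measurable_funD.
  apply: measurable_dot => i; last exact: bfm.
  under eq_fun do rewrite mxE.
  exact: (continuous_borel_cV (cp i)).
apply: measurable_funM => //.
apply: measurable_sum => j; under eq_fun do rewrite mxE.
apply: measurable_sum => i; apply: measurable_funM; last exact: bsm.
under eq_fun do rewrite mxE; apply: measurable_sum => i'.
under eq_fun do rewrite !mxE.
by apply: measurable_funM; [exact: bsm|exact: (continuous_borel_cV (cpp _ _))].
Qed.

Lemma borel_data_vector Nc (phi : 'cV[R]_n -> 'cV[R]_Nc) :
  (forall i, C2 (fun y => phi y i 0)) ->
  borel_fun (fun x => data_vector f sigma gamma phi x (mu x)).
Proof.
move=> Cphi i j; rewrite ord1; under eq_fun do rewrite data_vectorE.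
exact: borel_generator.
Qed.

End closed_loop.

(** * Integrating factors *)

Section exponential_weight.
Variable R : realType.
Local Notation leb := (@lebesgue_measure R).
Implicit Types (c s t r : R) (G q : R -> R).

Lemma is_derive_expR_scaled c r :
  is_derive r (1 : R) (fun s => expR (c * s)) (c * expR (c * r)).
Proof.
have dcr : is_derive r (1 : R) (fun s => c * s) c.
  by rewrite -[X in is_derive _ _ _ X]mulr1; exact: is_deriveZ.
have := is_derive1_comp (f := expR) (g := fun s => c * s)
  (is_derive_expR _) dcr.
by rewrite mulrC.
Qed.

Lemma continuous_expR_scaled c : continuous (fun s : R => expR (c * s)).
Proof.
move=> s; apply: continuous_comp; last exact: continuous_expR.
by apply: cvgMl_tmp; exact: cvg_id.
Qed.

Lemma measurable_expR_scaled c :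
  measurable_fun [set: R] (fun s => expR (c * s)).
Proof. by apply: continuous_measurable_fun; exact: continuous_expR_scaled. Qed.

Lemma integral_expR_scaled c r t : r <= t ->
  (\int[leb]_(s in `[r, t]) (c * expR (c * s))%:E)%E =
  (expR (c * t) - expR (c * r))%:E.
Proof.
rewrite le_eqVlt => /predU1P[->|rt].
  by rewrite set_itv1 integral_set1 subrr.
have cE := @continuous_expR_scaled c.
rewrite (continuous_FTC2 (F := fun s => expR (c * s)) rt) ?EFinB//.
- apply: continuous_subspaceT => s.
  by apply: cvgMl_tmp; exact: cE.
- split.
  + move=> s _.
    exact: (@ex_derive _ _ _ _ _ _ _ (is_derive_expR_scaled c s)).
  + by apply: cvg_at_right_filter; exact: cE.
  + by apply: cvg_at_left_filter; exact: cE.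
- move=> s _; rewrite derive1E.
  exact: (@derive_val _ _ _ _ _ _ _ (is_derive_expR_scaled c s)).
Qed.

Lemma integrable_expR_scaled c t :
  leb.-integrable `[0, t] (fun s => (expR (c * s))%:E).
Proof.
apply: continuous_compact_integrable; first exact: segment_compact.
by apply: continuous_subspaceT; exact: continuous_expR_scaled.
Qed.

Lemma integrable_restrictT (i : interval R) (h : R -> \bar R) :
  leb.-integrable [set` i] h -> leb.-integrable [set: R] (h \_ [set` i]).
Proof.
exact: (@integrable_mkcond _ _ _ leb [set` i] h (measurable_itv _)).1.
Qed.

(** The integral of c e^(cs) Q(s) over [0, t], where Q is the primitive of G,
    is a double integral over the triangle r <= s <= t. Integrating over s
    first leaves (e^(ct) - e^(cr)) G(r). *)
Section weighted_primitive.
Variables (c t : R) (G : R -> R).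
Hypothesis iG : leb.-integrable `[0, t] (fun r => (G r)%:E).

Local Notation D := (`[0, t]%classic : set R).
Let k s := c * expR (c * s).
Let F (p : R * R) : \bar R :=
  ((k \_ D) p.1 * (G \_ D) p.2 * \1_[set p : R * R | p.2 <= p.1] p)%:E.

Let ik : leb.-integrable D (fun s => (k s)%:E).
Proof.
rewrite (_ : (fun s => _) = (fun s => c%:E * (expR (c * s))%:E)%E)//.
by apply: integrableZl => //; exact: integrable_expR_scaled.
Qed.

Let mk : measurable_fun [set: R] (k \_ D).
Proof.
apply: (measurable_restrictT k (measurable_itv _)).1.
by apply/measurable_EFinP; exact: (measurable_int leb ik).
Qed.

Let mG : measurable_fun [set: R] (G \_ D).
Proof.
apply: (measurable_restrictT G (measurable_itv _)).1.
by apply/measurable_EFinP; exact: (measurable_int leb iG).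
Qed.

Let mF : measurable_fun [set: R * R] F.
Proof.
apply/measurable_EFinP; apply: measurable_funM.
  by apply: measurable_funM; apply: measurableT_comp.
apply: measurable_indic.
rewrite (_ : [set _ | _] =
    [set: R * R] `&` (fun p => p.2 <= p.1) @^-1` [set true]).
  by apply: measurable_fun_ler.
by rewrite setTI; apply/seteqP; split => p /=.
Qed.

Let iF : (leb \x leb)%E.-integrable [set: R * R] F.
Proof.
apply/integrable12ltyP => //.
have iGD : leb.-integrable [set: R] (EFin \o (G \_ D)).
  by rewrite -restrict_EFin; exact: integrable_restrictT iG.
have ikD : leb.-integrable [set: R] (EFin \o (k \_ D)).
  by rewrite -restrict_EFin; exact: integrable_restrictT ik.
have /integrableP[_ CG] := iGD; have /integrableP[_ Ck] := ikD.
set C := (\int[leb]_x _)%E in CG.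
have C0 : (0 <= C)%E by exact: integral_ge0.
apply: (@le_lt_trans _ _ (\int[leb]_s (C * `|(k \_ D) s|%:E))%E); last first.
  rewrite ge0_integralZl//; first by rewrite lte_mul_pinfty// ge0_fin_numE.
  by apply/measurable_EFinP; exact: measurableT_comp.
apply: ge0_le_integral => //.
- by move=> s _; exact: integral_ge0.
- apply: (measurable_fun_fubini_tonelli_F (m2 := leb) (abse \o F)).
    exact: measurableT_comp.
  by move=> p; exact: abse_ge0.
- apply: emeasurable_funM => //.
  by apply/measurable_EFinP; exact: measurableT_comp.
- move=> s _; rewrite muleC -ge0_integralZl//; last first.
    by apply/measurable_EFinP; exact: measurableT_comp.
  apply: ge0_le_integral => //.
  + apply: measurableT_comp => //.
    exact: (measurableT_comp mF (pair1_measurable s)).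
  + apply: emeasurable_funM => //.
    by apply/measurable_EFinP; exact: measurableT_comp.
  + move=> r _; rewrite /F /= -EFinM lee_fin !normrM indicE.
    rewrite ler_piMr ?mulr_ge0//.
    by case: (_ \in _); rewrite /= ?normr1 ?normr0.
Qed.

Let Q s := \int[leb]_(r in `[0, s]) G r.

Let FE s r : F (s, r) = ((k \_ D) s * (G \_ D) r * (r <= s)%R%:R)%:E.
Proof.
by rewrite /F /= indicE; congr (_ * (nat_of_bool _)%:R)%:E;
  apply/idP/idP; rewrite inE.
Qed.

Let innerL s : (\int[leb]_r F (s, r))%E = (EFin \o (fun s => k s * Q s)) \_ D s.
Proof.
rewrite patchE; case: ifPn => sD; last first.
  by apply: integral0_eq => r _; rewrite /F /= patchE (negbTE sD) !mul0r.
move: (sD); rewrite inE /= in_itv /= => /andP[s0 st].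
have iGs : leb.-integrable `[0, s] (EFin \o G).
  apply: integrableS iG => //; apply: subset_itvl; rewrite bnd_simp; exact: st.
transitivity (\int[leb]_r
    ((k s)%:E * ((EFin \o G) \_ (`[0%R, s]%classic : set R)) r))%E.
  apply: eq_integral => r _; rewrite FE !patchE sD !mem_setE !in_itv /=.
  have [rs|sr] := leP r s; last by rewrite !andbF !mulr0 mule0.
  rewrite andbT (le_trans rs st) andbT mulr1.
  by case: ifP => _; rewrite ?mulr0 ?mule0// EFinM.
rewrite integralZl//; last first.
  exact: integrable_restrictT iGs.
rewrite -integral_mkcond /= [RHS]EFinM /Q /Rintegral fineK//.
exact: integrable_fin_num.
Qed.

Let innerR r : (\int[leb]_s F (s, r))%E =
  (EFin \o (fun r => (expR (c * t) - expR (c * r)) * G r)) \_ D r.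
Proof.
rewrite patchE; case: ifPn => rD; last first.
  apply: integral0_eq => s _.
  by rewrite /F /= [X in _ * X * _]patchE (negbTE rD) mulr0 mul0r.
move: (rD); rewrite inE /= in_itv /= => /andP[r0 rt].
have iks : leb.-integrable `[r, t] (EFin \o k).
  apply: integrableS ik => //; apply: subset_itvr; rewrite bnd_simp; exact: r0.
transitivity (\int[leb]_s
    ((G r)%:E * ((EFin \o k) \_ (`[r, t]%classic : set R)) s))%E.
  apply: eq_integral => s _; rewrite FE !patchE rD !mem_setE !in_itv /=.
  have [rs|sr] := leP r s; last by rewrite !mulr0 mule0.
  rewrite mulr1 (le_trans r0 rs) /=.
  by case: ifP => _; rewrite ?mul0r ?mule0// -EFinM mulrC.
rewrite integralZl//; last first.
  exact: integrable_restrictT iks.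
by rewrite -integral_mkcond /= integral_expR_scaled// -EFinM mulrC.
Qed.

Lemma integrable_weighted_primitive :
  leb.-integrable D (fun s => (k s * Q s)%:E).
Proof.
apply: (@integrable_mkcond _ _ _ leb D (EFin \o (fun s => k s * Q s))
  (measurable_itv _)).2.
rewrite -(funext innerL); exact: integrable_fubini_F iF.
Qed.

Lemma integral_weighted_primitive :
  (\int[leb]_(s in D) (k s * Q s)%:E)%E =
  (\int[leb]_(r in D) ((expR (c * t) - expR (c * r)) * G r)%:E)%E.
Proof.
rewrite integral_mkcond [RHS]integral_mkcond.
rewrite -(funext innerL) -(funext innerR); exact: Fubini iF.
Qed.

End weighted_primitive.
End exponential_weight.

Section pathwise.
Variable R : realType.
Local Notation leb := (@lebesgue_measure R).

Lemma EFin_Rintegral (D : set R) (h : R -> R) : measurable D ->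
  leb.-integrable D (EFin \o h) ->
  (\int[leb]_(s in D) h s)%:E = (\int[leb]_(s in D) (h s)%:E)%E.
Proof.
by move=> mD ih; rewrite /Rintegral fineK//; exact: integrable_fin_num.
Qed.

Lemma integrable_expR_scaledM (c t : R) (G : R -> R) : 0 <= c ->
  leb.-integrable `[0, t] (fun r => (G r)%:E) ->
  leb.-integrable `[0, t] (fun r => (expR (c * r) * G r)%:E).
Proof.
move=> c0 iG.
apply: (le_integrable _ _ _ (integrableZl _ (expR (c * t)) iG)) => //.
  apply/measurable_EFinP; apply: measurable_funM.
    by apply: measurable_funTS; exact: measurable_expR_scaled.
  by apply/measurable_EFinP; exact: (measurable_int leb iG).
move=> s; rewrite /= in_itv /= => /andP[s0 st].
rewrite lee_fin !normrM ler_wpM2r// !ger0_norm ?expR_ge0//.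
by rewrite ler_expR ler_wpM2l.
Qed.

(** The product rule for e^(cs) z in integrated form. As z is only the primitive
    of an integrable function, it comes from [integral_weighted_primitive]: the
    terms - e^(cr) G there cancel against the a e^(cs) G here. *)
Lemma weighted_integral (a c z0 t : R) (z G : R -> R) : 0 <= c -> 0 <= t ->
  leb.-integrable `[0, t] (fun r => (G r)%:E) ->
  (forall s, 0 <= s <= t -> z s = z0 - a * \int[leb]_(r in `[0, s]) G r) ->
  leb.-integrable `[0, t] (fun s => (expR (c * s) * (c * z s - a * G s))%:E) /\
  \int[leb]_(s in `[0, t]) (expR (c * s) * (c * z s - a * G s)) =
  expR (c * t) * z t - z0.
Proof.
move=> c0 t0 iG zE.
pose Q s := \int[leb]_(r in `[0, s]) G r.
have iE := integrable_expR_scaled c t.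
have iEG := integrable_expR_scaledM c0 iG.
have iQ := @integrable_weighted_primitive R c t G iG.
pose h1 s := c * expR (c * s) * Q s + expR (c * s) * G s.
pose h2 s := (z0 * c) * expR (c * s).
have ih1 : leb.-integrable `[0, t] (EFin \o h1).
  by apply: (integrableD _ iQ iEG).
have ih2 : leb.-integrable `[0, t] (EFin \o h2).
  by apply: (integrableZl _ (z0 * c) iE).
have iah1 : leb.-integrable `[0, t] (EFin \o (fun s => a * h1 s)).
  by apply: (integrableZl _ a ih1).
have hE : {in `[0, t]%classic, forall s,
    expR (c * s) * (c * z s - a * G s) = h2 s - a * h1 s}.
  by move=> s; rewrite inE /= in_itv /= => /zE ->; rewrite /h1 /h2 /Q; ring.
split.
  apply: (@eq_integrable _ _ _ leb `[0, t]%classic _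
    (EFin \o (fun s => h2 s - a * h1 s))) => //.
    by move=> s sD /=; rewrite hE.
  by apply: (integrableB _ ih2 iah1).
rewrite (eq_Rintegral leb hE).
rewrite RintegralB// RintegralZl//.
have -> : \int[leb]_(s in `[0, t]) h1 s = expR (c * t) * Q t.
  rewrite RintegralD//.
  rewrite {1}/Rintegral (@integral_weighted_primitive R c t G iG).
  rewrite -/(Rintegral _ _ (fun r => (expR (c * t) - expR (c * r)) * G r)).
  rewrite -RintegralD//; last first.
    apply: (@eq_integrable _ _ _ leb `[0, t]%classic _
      (EFin \o (fun r => expR (c * t) * G r - expR (c * r) * G r))) => //.
      by move=> r _ /=; rewrite mulrBl.
    by apply: (integrableB _ (integrableZl _ (expR (c * t)) iG) iEG).
  rewrite -RintegralZl//; apply: eq_Rintegral => s _; ring.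
have -> : \int[leb]_(s in `[0, t]) h2 s = z0 * (expR (c * t) - 1).
  rewrite /Rintegral
    (_ : (fun s => _) = (fun s => z0%:E * (c * expR (c * s))%:E)%E).
    rewrite integralZl//.
      by rewrite integral_expR_scaled// mulr0 expR0.
    by apply: (integrableZl _ c iE).
  by apply/funext => s; rewrite -EFinM mulrA.
by rewrite zE ?t0 ?lexx// -/(Q t); ring.
Qed.

(** The right-hand side is an extended real, because q may fail to be
    integrable along a single path; only its expectation is controlled. *)
Lemma pathwise_gronwall (a c z0 t : R) (z G q : R -> R) : 0 <= c -> 0 <= t ->
  leb.-integrable `[0, t] (fun r => (G r)%:E) ->
  (forall s, 0 <= s <= t -> z s = z0 - a * \int[leb]_(r in `[0, s]) G r) ->
  measurable_fun `[0, t] q -> (forall s, 0 <= q s) ->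
  {ae leb, forall s, 0 <= s -> c * z s - a * G s <= q s} ->
  ((expR (c * t) * z t)%:E <=
   z0%:E + \int[leb]_(s in `[0%R, t]) (expR (c * s) * q s)%:E)%E.
Proof.
move=> c0 t0 iG zE mq q0 zq.
have [ih hE] := weighted_integral c0 t0 iG zE.
rewrite -(subrK z0 (expR (c * t) * z t)) -hE EFinD addeC leeD2l//.
rewrite EFin_Rintegral//.
set h := (fun s => (expR (c * s) * (c * z s - a * G s))%:E) in ih *.
have mEq : measurable_fun `[0, t] (fun s => (expR (c * s) * q s)%:E).
  apply/measurable_EFinP; apply: measurable_funM => //.
  by apply: measurable_funTS; exact: measurable_expR_scaled.
apply: (@le_trans _ _ (\int[leb]_(s in `[0%R, t]) h^\+ s)%E).
  rewrite integralE -[leRHS]sube0; apply: leeB => //.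
  exact: integral_ge0.
apply: ae_ge0_le_integral => //.
- by apply: measurable_funepos; exact: (measurable_int leb ih).
- by move=> s _; rewrite lee_fin mulr_ge0 ?expR_ge0.
- move: zq; apply: filterS; first exact: (ae_filter_ringOfSetsType leb).
  move=> s /= zqs; rewrite in_itv /= => /andP[s0 _].
  rewrite funeposE /h -EFin_max lee_fin ge_max mulr_ge0 ?expR_ge0// andbT.
  by rewrite ler_wpM2l ?expR_ge0// zqs.
Qed.

End pathwise.

(** * Expectations *)

Section ae_swap.
Context (R : realType) (d1 d2 : measure_display).
Context (T1 : measurableType d1) (T2 : measurableType d2).
Variables (m1 : {sigma_finite_measure set T1 -> \bar R}).
Variables (m2 : {sigma_finite_measure set T2 -> \bar R}).

(** The complement of A has null sections in one direction; by Tonelli's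
    theorem it is a null set of the product, hence has almost surely null
    sections in the other direction. *)
Lemma ae_swap (A : set (T1 * T2)) : measurable A ->
  (forall x, {ae m2, forall y, A (x, y)}) ->
  {ae m2, forall y, {ae m1, forall x, A (x, y)}}.
Proof.
move=> mA Ax.
have mB : measurable (~` A) by exact: measurableC.
have := indic_fubini_tonelli m1 m2 mB.
rewrite indic_fubini_tonelli_FE// indic_fubini_tonelli_GE//.
rewrite [LHS]integral0_eq; last first.
  move=> x _ /=; apply: measure_negligible; first exact: measurable_xsection.
  apply: negligibleS (Ax x) => y; rewrite /xsection /= inE; exact.
have mG : measurable_fun [set: T2] (m1 \o ysection (~` A)).
  exact: measurable_fun_ysection.
move=> /esym G0.
have : ae_eq m2 [set: T2] (m1 \o ysection (~` A)) (cst 0%E).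
  apply/ae_eq_integral_abs => //; rewrite -[RHS]G0.
  by apply: eq_integral => y _; rewrite gee0_abs.
apply: filterS => y /(_ Logic.I) /= y0.
exists (ysection (~` A) y); split => //; first exact: measurable_ysection.
by move=> x Axy; rewrite /ysection /= inE.
Qed.

End ae_swap.

Section expectation.
Context (R : realType) (d : measure_display) (T : measurableType d).
Variable P : probability T R.
Local Notation leb := (@lebesgue_measure R).

(** Stated for extended reals, as the second moments may be infinite. *)
Lemma expectation_cauchy_schwarz (x y : T -> R) :
  measurable_fun [set: T] x -> measurable_fun [set: T] y ->
  (forall w, 0 <= x w) -> (forall w, 0 <= y w) ->
  (\int[P]_w (x w * y w)%:E <=
   sqrte (\int[P]_w (x w ^+ 2)%:E) * sqrte (\int[P]_w (y w ^+ 2)%:E))%E.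
Proof.
move=> mx my x0 y0.
have half : (2^-1 + 2^-1 = 1 :> R)%R by rewrite [RHS]splitr div1r.
have N2 (f : T -> R) : (forall w, 0 <= f w) ->
    'N[P]_2%:E[EFin \o f]%E = sqrte (\int[P]_w (f w ^+ 2)%:E).
  move=> f0; rewrite unlock /= poweR12_sqrt; last first.
    by apply: integral_ge0 => w _; rewrite lee_fin powR_ge0.
  congr sqrte; apply: eq_integral => w _.
  by rewrite /= ger0_norm// powR_mulrn.
have := hoelder P mx my (ltr0Sn R 1) (ltr0Sn R 1) half.
rewrite N2// N2// Lnorm1; apply: le_trans; rewrite le_eqVlt; apply/orP; left.
by apply/eqP; apply: eq_integral => w _; rewrite /= ger0_norm// mulr_ge0.
Qed.

(** The expectation of [pathwise_gronwall]: Tonelli's theorem moves the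
    expectation inside the time integral, where it is at most K, and the
    integral of e^(cs) over [0, t] is at most e^(ct) / c. *)
Lemma expected_gronwall (a c z0 t K : R) (z G q : R -> T -> R) :
  measurable_fun [set: T] (z t) ->
  measurable_fun [set: R * T] (fun p => q p.1 p.2) ->
  (forall s w, 0 <= z s w) -> (forall s w, 0 <= q s w) ->
  0 <= z0 -> 0 < c -> 0 <= t -> 0 <= K ->
  {ae P, forall w, forall s, 0 <= s ->
    leb.-integrable `[0, s] (fun r => (G r w)%:E) /\
    z s w = z0 - a * \int[leb]_(r in `[0, s]) G r w} ->
  {ae P, forall w, {ae leb, forall s, 0 <= s ->
    c * z s w - a * G s w <= q s w}} ->
  (forall s, 0 <= s <= t -> (\int[P]_w (q s w)%:E <= K%:E)%E) ->
  (\int[P]_w (z t w)%:E <= (expR (- (c * t)) * z0 + K / c)%:E)%E.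
Proof.
move=> mz mq z_ge0 q_ge0 z00 c0 t0 K0 zE zq qK.
pose g (p : R * T) :=
  (\1_(`[0, t]%classic : set R) p.1 * expR (c * p.1) * q p.1 p.2)%:E.
have mg : measurable_fun [set: R * T] g.
  apply/measurable_EFinP; apply: measurable_funM => //.
  apply: measurable_funM; last first.
    exact: (measurableT_comp (measurable_expR_scaled c) measurable_fst).
  by apply: (measurableT_comp _ measurable_fst); exact: measurable_indic.
have g0 p : (0 <= g p)%E by rewrite lee_fin !mulr_ge0 ?expR_ge0.
have gE w : (\int[leb]_(s in `[0%R, t]) (expR (c * s) * q s w)%:E =
             \int[leb]_s g (s, w))%E.
  rewrite integral_mkcond; apply: eq_integral => s _.
  rewrite patchE /g /= indicE; case: ifPn => _; last by rewrite !mul0r.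
  by rewrite mul1r.
have int_g : (\int[P]_w \int[leb]_s g (s, w) <= (K * expR (c * t) / c)%:E)%E.
  rewrite -(fubini_tonelli (m1 := leb) (m2 := P) g mg g0).
  apply: (@le_trans _ _ (\int[leb]_(s in `[0%R, t])
      ((K / c)%:E * (c * expR (c * s))%:E))%E); last first.
    rewrite ge0_integralZl//.
    + rewrite integral_expR_scaled// -EFinM lee_fin mulr0 expR0.
      by rewrite [leRHS]mulrAC ler_wpM2l ?divr_ge0 ?(ltW c0)// gerBl.
    + apply/measurable_EFinP; apply: measurable_funTS.
      by apply: measurable_funM => //; exact: measurable_expR_scaled.
    + by move=> s _; rewrite lee_fin mulr_ge0 ?expR_ge0 ?ltW.
    + by rewrite lee_fin divr_ge0 ?(ltW c0).
  rewrite [leRHS]integral_mkcond; apply: ge0_le_integral => //.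
  - by move=> s _; exact: integral_ge0.
  - exact: (measurable_fun_fubini_tonelli_F (m2 := P) g).
  - apply: (measurable_restrictT _ _).1 => //; apply: emeasurable_funM => //.
    apply/measurable_EFinP; apply: measurable_funTS.
    by apply: measurable_funM => //; exact: measurable_expR_scaled.
  - move=> s _; rewrite patchE; case: ifPn => sD; last first.
      by rewrite integral0_eq// => w _; rewrite /g /= indicE (negbTE sD) !mul0r.
    move: (sD); rewrite inE /= in_itv /= => st.
    under eq_integral do rewrite /g /= indicE sD mul1r EFinM.
    rewrite ge0_integralZl//.
    + rewrite -EFinM (_ : K / c * _ = expR (c * s) * K).
        rewrite EFinM; apply: lee_wpmul2l; last exact: qK.
        by rewrite lee_fin expR_ge0.
      by rewrite mulrA divfK ?gt_eqF// mulrC.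
    + apply/measurable_EFinP; exact: (measurableT_comp mq (pair1_measurable s)).
    + by move=> w _; rewrite lee_fin.
have main : (\int[P]_w (expR (c * t) * z t w)%:E <=
    (z0 + K * expR (c * t) / c)%:E)%E.
  apply: (@le_trans _ _ (\int[P]_w (z0%:E + \int[leb]_s g (s, w)))%E).
    apply: ae_ge0_le_integral => //.
    - by move=> w _; rewrite lee_fin mulr_ge0 ?expR_ge0.
    - by apply/measurable_EFinP; exact: measurable_funM.
    - by move=> w _; rewrite adde_ge0 ?lee_fin ?integral_ge0.
    - apply: emeasurable_funD => //.
      exact: (measurable_fun_fubini_tonelli_G (m1 := leb) g).
    - apply: (filterS2 _ _ zE zq) => w zEw zqw _.
      rewrite -gE; have [iG _] := zEw t t0.
      apply: (pathwise_gronwall (ltW c0) t0 iG _ _ _ zqw) => //.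
        by move=> s /andP[s0 _]; exact: (zEw s s0).2.
      apply: measurable_funTS.
      exact: (measurableT_comp mq (pair2_measurable w)).
  rewrite ge0_integralD//.
  - rewrite integral_cst// EFinD leeD//.
    by rewrite -[leRHS]mule1 lee_wpmul2l// probability_le1.
  - by move=> w _; rewrite integral_ge0.
  - exact: (measurable_fun_fubini_tonelli_G (m1 := leb) g).
have zexp : (\int[P]_w (expR (c * t) * z t w)%:E =
    (expR (c * t))%:E * \int[P]_w (z t w)%:E)%E.
  under eq_integral do rewrite EFinM.
  rewrite ge0_integralZl//; first exact/measurable_EFinP.
  by move=> w _; rewrite lee_fin.
move: main; rewrite zexp -lee_pdivlMl ?expR_gt0//.
move=> /le_trans; apply; rewrite -EFinM lee_fin -expRN mulrDr lerD2l.
by rewrite expRN mulrC mulrAC mulfK// gt_eqF ?expR_gt0.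
Qed.

End expectation.

(** * The critic weight error *)

Section drift.
Variables (R : realType) (p M : nat).

Lemma drift_lower_bound (W : 'I_M -> 'cV[R]_p) (z s : 'cV[R]_p)
    (r b : 'I_M -> R) (e : R) :
  e * enorm z ^+ 2 <= dot z (excitation W *m z) ->
  (forall k, `|r k| <= b k) ->
  e * enorm z ^+ 2 - enorm z * \sum_k (enorm s + b k) <=
  dot z (excitation W *m z)
  + \sum_k dot z (W k) * (dot s (W k) + r k) / (dot (W k) (W k) + 1) ^+ 2.
Proof.
move=> ez rb; rewrite lerD// mulr_sumr -sumrN; apply: ler_sum => k _.
apply: lerNnormlW.
apply: (le_trans (residual_term_bound z (W k) s (r k))).
by rewrite ler_wpM2l ?enorm_ge0// lerD2l.
Qed.

End drift.

(** By (b + c)^2 <= 2 (b^2 + c^2). *)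
Lemma integral_sqr_quadratic_le (R : realType) (d : measure_display)
    (T : measurableType d) (P : probability T R) (b C v : R) (y : T -> R) :
  measurable_fun [set: T] y -> (\int[P]_w (y w ^+ 4)%:E <= v%:E)%E ->
  (\int[P]_w ((b + C * y w ^+ 2) ^+ 2)%:E <= (2 * (b ^+ 2 + C ^+ 2 * v))%:E)%E.
Proof.
move=> my yv.
have b2 : 0 <= 2 * b ^+ 2 by rewrite mulr_ge0// sqr_ge0.
have c2 : 0 <= 2 * C ^+ 2 by rewrite mulr_ge0// sqr_ge0.
apply: (@le_trans _ _ (\int[P]_w ((2 * b ^+ 2)%:E
    + (2 * C ^+ 2)%:E * (y w ^+ 4)%:E))%E).
  apply: ge0_le_integral => //.
  - by move=> w _; rewrite lee_fin sqr_ge0.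
  - apply/measurable_EFinP; apply: measurable_funX.
    apply: measurable_funD => //.
    by apply: measurable_funM => //; exact: measurable_funX.
  - apply: emeasurable_funD => //; apply: emeasurable_funM => //.
    by apply/measurable_EFinP; exact: measurable_funX.
  - move=> w _; rewrite -EFinM -EFinD lee_fin -subr_ge0.
    rewrite (_ : _ - _ = (b - C * y w ^+ 2) ^+ 2) ?sqr_ge0//; ring.
have my4 : measurable_fun [set: T] (fun w => (y w ^+ 4)%:E).
  by apply/measurable_EFinP; exact: measurable_funX.
have y4 w : 0 <= y w ^+ 4 by rewrite (exprM (y w) 2 2) sqr_ge0.
rewrite ge0_integralD//; last 2 first.
- by move=> w _; rewrite -EFinM lee_fin mulr_ge0.
- exact: emeasurable_funM.
rewrite integral_cst// mulrDr EFinD; apply: leeD.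
  by rewrite -[leRHS]mule1 lee_wpmul2l ?probability_le1// lee_fin.
rewrite ge0_integralZl//; last by move=> w _; rewrite lee_fin.
by rewrite mulrA [leRHS]EFinM lee_wpmul2l.
Qed.

Lemma ereal_sup_image_ge (R : realType) (I : Type) (A : set I)
  (h : I -> \bar R) i : A i -> (h i <= ereal_sup [set h j | j in A])%E.
Proof. by move=> Ai; apply: ereal_sup_ubound; exists i. Qed.

Theorem theorem1 (R : realType) (d : measure_display) (T : measurableType d)
    (P : probability T R) (n m l Nc M : nat) (t0 : R)
    (* environment *)
    (F : R -> set (set T)) (B : R -> T -> 'cV[R]_l)
    (f : 'cV[R]_n -> 'cV[R]_m -> 'cV[R]_n)
    (sigma : 'cV[R]_n -> 'cV[R]_m -> 'M[R]_(n, l))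
    (mu : 'cV[R]_n -> 'cV[R]_m)
    (X : R -> T -> 'cV[R]_n) (U : R -> T -> 'cV[R]_m)
    (* optimal control problem *)
    (rho : 'cV[R]_n -> 'cV[R]_m -> R) (gamma : R) (V : 'cV[R]_n -> R)
    (* critic *)
    (phi : 'cV[R]_n -> 'cV[R]_Nc) (theta_star : 'cV[R]_Nc)
    (delta : 'cV[R]_n -> R) (tk : R -> 'I_M -> R)
    (Theta : R -> T -> 'cV[R]_Nc) (theta_tilde0 : 'cV[R]_Nc)
    (alpha eps Xbar : R) :
  let W := fun t w => data_vector f sigma gamma phi (X t w) (U t w) in
  let E := fun t w => excitation (fun k => W (tk t k) w) in
  let Theta_tilde := fun t w => Theta t w - theta_star in
  let G := fun t w =>
    dot (Theta_tilde t w) (E t w *m Theta_tilde t w)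
    + \sum_(k < M)
        dot (Theta_tilde t w) (W (tk t k) w)
        * (hamiltonian f sigma rho gamma V (X (tk t k) w) (U (tk t k) w)
           - hamiltonian_error f sigma gamma delta (X (tk t k) w) (U (tk t k) w))
        / (dot (W (tk t k) w) (W (tk t k) w) + 1) ^+ 2 in
  t0 <= 0 -> (0 < M)%N ->
  borel_fun2 f -> borel_fun2 sigma ->
  borel_fun2 (fun x u => (rho x u)%:M : 'M[R]_1) -> borel_fun mu ->
  filtration t0 F -> brownian_motion P t0 F B ->
  (* dX_t = f(X_t, U_t) dt + sigma(X_t, U_t) dB_t with U_t = mu(X_t) *)
  sde_solution P t0 F B (fun x => f x (mu x)) (fun x => sigma x (mu x)) X ->
  (forall t w, U t w = mu (X t w)) ->
  value_function P F B f sigma rho gamma V ->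
  C2 V -> (forall i, C2 (fun x => phi x i 0)) ->
  (forall x, V x = dot theta_star (phi x) + delta x) ->
  replay_times t0 tk ->
  (* evolution of the critic weight error *)
  0 < alpha ->
  measurable_process 0 Theta ->
  {ae P, forall w, Theta_tilde 0 w = theta_tilde0} ->
  {ae P, forall w, forall t, 0 <= t ->
     lebesgue_measure.-integrable `[0, t] (fun r => (G r w)%:E) /\
     enorm (Theta_tilde t w) ^+ 2 =
       enorm theta_tilde0 ^+ 2
       - alpha * \int[lebesgue_measure]_(r in `[0, t]) G r w} ->
  (* (a) *)
  linear_growth (fun x => f x (mu x)) ->
  linear_growth (fun x => sigma x (mu x)) ->
  mu 0 = 0 -> f 0 0 = 0 -> sigma 0 0 = 0 ->
  (* (b) *)
  quadratic_growth delta -> delta 0 = 0 ->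
  (* (c) *)
  quadratic_growth (fun x => rho x (mu x)) -> quadratic_growth V ->
  (* (d) *)
  0 < eps ->
  (forall t, 0 <= t -> {ae P, forall w, loewner_ge (E t w) (eps%:M)}) ->
  (* (e) *)
  0 < Xbar ->
  (forall t, t0 <= t -> ('E_P[fun w => (enorm (X t w) ^+ 4)%R] <= (Xbar ^+ 2)%R%:E)%E) ->
  exists D : R, forall t, 0 <= t ->
    ('E_P[fun w => (enorm (Theta_tilde t w) ^+ 2)%R] <=
       (expR (- (alpha * eps * t)) * enorm theta_tilde0 ^+ 2)%R%:E
       + D%:E * ereal_sup
           [set sqrte ('E_P[fun w => (enorm (Theta_tilde tau w) ^+ 2)%R])
             | tau in `[0%R, t]])%E.
Proof.
move=> W E Theta_tilde G t0_le0 M0 bf bsigma _ bmu Ffilt _ solX UE _ CV Cphi VE.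
move=> [mtk tkP] alpha0 mTheta _ evol _ _ _ _ _ _ _ [C0 rhoC] _ eps0 exc _ X4.
have [[cX mX] _] := solX.
pose C := `|C0|.
pose b := enorm theta_star + C.
(* K1 bounds the L^2 norm of b + C |X|^2. The summand 1 makes it positive, so
   that the claim is trivial when the supremum is infinite. *)
pose K1 := Num.sqrt (2 * (b ^+ 2 + C ^+ 2 * Xbar ^+ 2)) + 1.
have C_ge0 : 0 <= C by exact: normr_ge0.
have b_ge0 : 0 <= b by rewrite addr_ge0 ?enorm_ge0.
have K1_gt0 : 0 < K1 by rewrite ltr_wpDl ?sqrtr_ge0.
have MK0 : 0 < M%:R * K1 / eps by rewrite divr_gt0 ?mulr_gt0 ?ltr0n.
exists (M%:R * K1 / eps) => t t_ge0.
set S := ereal_sup _.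
have S0 : (0 <= S)%E.
  apply: le_trans (ereal_sup_image_ge _ (i := 0) _); first exact: sqrte_ge0.
  by rewrite /= in_itv /= lexx.
case S_val : S S0 => [s| |] // S0; last first.
  by rewrite gt0_muley ?lte_fin// addey// leey.
have s0 : 0 <= s by rewrite -lee_fin.
(* Replacing negative times by 0 makes all processes measurable on the whole
   line, without changing them from time 0 on. *)
pose pos (r : R) := Num.max 0 r.
have pos0 r : 0 <= pos r by rewrite le_max lexx.
have posE r : 0 <= r -> pos r = r by move=> r0; rewrite /pos max_r.
have mpos : measurable_fun [set: R] pos by exact: measurable_maxr.
have sub_pos : pos @` [set: R] `<=` `[0, +oo[.
  by move=> _ [r _ <-] /=; rewrite in_itv /= pos0.
pose th r w := Theta_tilde (pos r) w.
pose x k r w := X (tk (pos r) k) w.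
have tk_ge k r : t0 <= tk (pos r) k by have [] := tkP _ (pos0 r).
have mth i : measurable_fun [set: R * T] (fun p => th p.1 p.2 i 0).
  under eq_fun do rewrite /th /Theta_tilde !mxE.
  apply: measurable_funB => //.
  rewrite (_ : (fun p => _) = (fun p : R * T => Theta p.1 p.2 i 0)
    \o (fun p : R * T => (pos p.1, p.2)))//.
  apply: (@measurable_comp _ _ _ (R * T)%type (R * T)%type R
    (`[0, +oo[ `*` [set: T]) (fun p : R * T => Theta p.1 p.2 i 0) setT
    (fun p : R * T => (pos p.1, p.2))).
  - exact: measurableX.
  - by move=> _ [[r w] _ <-] /=; split => //; rewrite in_itv /= pos0.
  - exact: mTheta.
  - apply: measurable_fun_pair; last exact: measurable_snd.
    exact: (measurableT_comp mpos measurable_fst).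
have mtkpos k : measurable_fun [set: R] (fun r => tk (pos r) k).
  by apply: (measurable_comp _ sub_pos (mtk k) mpos); exact: measurable_itv.
have mX' i r : t0 <= r -> measurable_fun [set: T] (fun w => X r w i 0).
  move=> r0 _ Y mY; rewrite setTI.
  by case: Ffilt => _ /(_ r r0) sub _; apply: sub; exact: mX.
have mx k i : measurable_fun [set: R * T] (fun p => x k p.1 p.2 i 0).
  exact: (measurable_sampled_process (cX i) (mX' i) (mtkpos k) (tk_ge k)).
have mw k i : measurable_fun [set: R * T]
    (fun p => W (tk (pos p.1) k) p.2 i 0).
  rewrite (_ : (fun p => _) = (fun y : borel_cV R n =>
    data_vector f sigma gamma phi y (mu y) i 0) \o (fun p => x k p.1 p.2)).
    apply: measurableT_comp; first exact: borel_data_vector.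
    exact: measurable_fun_borel_cV.
  by apply/funext => -[r w] /=; rewrite /W UE.
have m_norm : measurable_fun [set: R * T] (fun p => enorm (th p.1 p.2)).
  exact: measurable_enorm.
have m_x k : measurable_fun [set: R * T] (fun p => enorm (x k p.1 p.2)).
  exact: measurable_enorm.
pose r_ k r w := b + C * enorm (x k r w) ^+ 2.
have m_r k : measurable_fun [set: R * T] (fun p => r_ k p.1 p.2).
  apply: measurable_funD => //; apply: measurable_funM => //.
  exact: measurable_funX.
have r_ge0 k r w : 0 <= r_ k r w.
  by apply: addr_ge0 => //; apply: mulr_ge0 => //; exact: sqr_ge0.
pose q r w := alpha * (enorm (th r w) * \sum_k r_ k r w).
have ae_exc : {ae P, forall w, {ae lebesgue_measure, forall r,
    eps * enorm (th r w) ^+ 2 <=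
      dot (th r w) (E (pos r) w *m th r w)}}.
  pose A := [set p : R * T | eps * enorm (th p.1 p.2) ^+ 2 <=
    dot (th p.1 p.2) (E (pos p.1) p.2 *m th p.1 p.2)].
  have mA : measurable A.
    rewrite (_ : A = [set: R * T] `&`
      (fun p => eps * enorm (th p.1 p.2) ^+ 2 <=
         dot (th p.1 p.2) (E (pos p.1) p.2 *m th p.1 p.2)) @^-1` [set true]).
      apply: measurable_fun_ler => //.
        by apply: measurable_funM => //; exact: measurable_funX.
      exact: (measurable_excitation_quad
        (W := fun p k => W (tk (pos p.1) k) p.2)).
    by rewrite setTI; apply/seteqP; split.
  apply: (@ae_swap _ _ _ _ _ (@lebesgue_measure R) P A mA) => r.
  by have := exc _ (pos0 r); apply: filterS => w; exact: loewner_ge_quad.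
have -> : expectation P (fun w => enorm (Theta_tilde t w) ^+ 2) =
    (\int[P]_w (enorm (th t w) ^+ 2)%:E)%E.
  by rewrite unlock /th posE.
rewrite -EFinM -EFinD.
rewrite (_ : expR _ * _ + _ =
    expR (- (alpha * eps * t)) * enorm theta_tilde0 ^+ 2
    + (alpha * (M%:R * (s * K1))) / (alpha * eps)); last first.
  by congr (_ + _); field; rewrite !gt_eqF.
apply: (@expected_gronwall _ _ _ P alpha _ _ _ _
  (fun r w => enorm (th r w) ^+ 2) G q) => //.
- apply: measurable_funX.
  exact: (measurableT_comp m_norm (pair1_measurable t)).
- apply: measurable_funM => //; apply: measurable_funM => //.
  exact: measurable_sum.
- by move=> r w; exact: sqr_ge0.
- move=> r w; apply: mulr_ge0; first exact: ltW.
  by apply: mulr_ge0; [exact: enorm_ge0|exact: sumr_ge0].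
- exact: sqr_ge0.
- by rewrite mulr_gt0.
- by rewrite mulr_ge0 ?(ltW alpha0)// mulr_ge0// mulr_ge0// ltW.
- apply: filterS evol => w evol_w r r0; rewrite /th posE//; exact: evol_w.
- apply: filterS ae_exc => w.
  apply: filterS; first exact: (ae_filter_ringOfSetsType (@lebesgue_measure R)).
  move=> r /= exc_r r0; rewrite -mulrA -mulrBr /q ler_wpM2l ?(ltW alpha0)//.
  have rho_r k : `|rho (x k r w) (U (tk (pos r) k) w)| <=
      C * (1 + enorm (x k r w) ^+ 2).
    rewrite UE (le_trans (rhoC _))// ler_wpM2r ?ler_norm//.
    by rewrite addr_ge0 ?sqr_ge0.
  have := drift_lower_bound (W := fun k => W (tk (pos r) k) w)
    theta_star exc_r rho_r.
  have -> : \sum_k (enorm theta_star + C * (1 + enorm (x k r w) ^+ 2)) =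
      \sum_k r_ k r w.
    by apply: eq_bigr => k _; rewrite /r_ /b; ring.
  rewrite lerBlDr => low; rewrite lerBlDr addrC (le_trans low)// lerD2r.
  rewrite /th /x posE// /G lerD2l ler_sum// => k _.
  by rewrite -(hamiltonian_residual f sigma gamma rho _ _ CV Cphi VE).
- move=> r /andP[r0 rt].
  have Er : (sqrte (\int[P]_w (enorm (th r w) ^+ 2)%:E) <= s%:E)%E.
    rewrite -S_val; apply: le_trans (ereal_sup_image_ge _ (i := r) _).
      by rewrite unlock /th posE.
    by rewrite /= in_itv /= r0.
  have Erk k : (\int[P]_w (enorm (th r w) * r_ k r w)%:E <= (s * K1)%:E)%E.
    apply: (le_trans (expectation_cauchy_schwarz P _ _ _ _)).
    + exact: (measurableT_comp m_norm (pair1_measurable r)).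
    + exact: (measurableT_comp (m_r k) (pair1_measurable r)).
    + by move=> w; exact: enorm_ge0.
    + by move=> w; exact: r_ge0.
    rewrite EFinM; apply: lee_pmul => //; [exact: sqrte_ge0|exact: sqrte_ge0|].
    apply: (@le_trans _ _ (sqrte (2 * (b ^+ 2 + C ^+ 2 * Xbar ^+ 2))%:E)).
      rewrite lee_sqrt; last first.
        by rewrite lee_fin mulr_ge0// addr_ge0 ?sqr_ge0// mulr_ge0 ?sqr_ge0.
      apply: (integral_sqr_quadratic_le b C (y := fun w => enorm (x k r w))).
        exact: (measurableT_comp (m_x k) (pair1_measurable r)).
      by have := X4 _ (tk_ge k r); rewrite unlock.
    by rewrite lee_fin lerDl.
  rewrite /q; under eq_integral do rewrite EFinM mulr_sumr -sumEFin.
  have mEk k : measurable_fun [set: T]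
      (fun w => (enorm (th r w) * r_ k r w)%:E).
    apply/measurable_EFinP; apply: measurable_funM.
      exact: (measurableT_comp m_norm (pair1_measurable r)).
    exact: (measurableT_comp (m_r k) (pair1_measurable r)).
  have Ek0 k w : (0 <= (enorm (th r w) * r_ k r w)%:E)%E.
    by rewrite lee_fin mulr_ge0 ?enorm_ge0.
  rewrite ge0_integralZl//; last 3 first.
  + exact: emeasurable_sum.
  + by move=> w _; exact: sume_ge0.
  + by rewrite lee_fin ltW.
  rewrite EFinM lee_wpmul2l ?lee_fin ?(ltW alpha0)//.
  rewrite ge0_integral_sum//.
  apply: (@le_trans _ _ (\sum_(k < M) (s * K1)%:E)%E); first exact: lee_sum.
  by rewrite sumEFin sumr_const card_ord mulr_natl.
Qed.
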